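(* Let $(\mathcal{E},\mathcal{E}')$ be a nested pair of ellipses in the plane ($\mathcal{E}'$ inside $\mathcal{E}$, not necessarily concentric or axis-aligned) admitting a family of Poncelet triangles. Let $X_k$ be a triangle center which is stationary over this family, and let $\mathcal{X}=\alpha X_2+\beta X_3+\gamma X_k$ with constants $\alpha,\beta,\gamma\in\mathbb{C}$ not depending on the triangle. Suppose that the elliptical locus of $\mathcal{X}$ over the family is not degenerate. Then over a full cycle of the Poncelet triangles, the winding number of $\mathcal{X}$ over its elliptical locus is $+3$ or $-3$.
   Context: The plane is identified with $\mathbb{C}$, with a fixed origin, so that points can be linearly combined with complex coefficients. A Poncelet triangle of the pair $(\mathcal{E},\mathcal{E}')$ is a triangle with its three vertices on $\mathcal{E}$ and its three side lines tangent to $\mathcal{E}'$. By Poncelet's closure theorem, if one such triangle exists then every point of $\mathcal{E}$ is a vertex of exactly one such triangle; the resulting one-parameter family is the family of Poncelet triangles. A triangle center is a point assigned to each triangle, independently of the labelling of the vertices and compatibly with similarities of the plane; it is stationary over the family if it is the same point for all triangles of the family. $X_2$ denotes the barycenter (centroid) and $X_3$ the circumcenter. The locus of $\mathcal{X}$ is the set of its positions over the family; it is known to be an ellipse, possibly degenerate. It is called degenerate if one or both of its semi-axes are zero, i.e. if it is a segment or a single point. A full cycle of the family means that a chosen vertex of the triangle, followed continuously, travels exactly once counterclockwise around the outer ellipse $\mathcal{E}$. The winding number of $\mathcal{X}$ over its locus is the winding number, about the center of the locus ellipse, of the closed curve described by $\mathcal{X}$ during this full cycle. *)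

(* Defs.v *)
From Stdlib Require Import Reals ZArith.
From Coquelicot Require Import Coquelicot.

Open Scope R_scope.

(** Semi-axes are allowed to vanish, so that a locus can degenerate to a
    segment or a point; circles are ellipses. *)
Record ellipse := Ellipse {
  center : C;
  axis : C;
  semi1 : R;
  semi2 : R;
  axis_unit : Cmod axis = 1;
  semi1_ge0 : 0 <= semi1;
  semi2_ge0 : 0 <= semi2 }.

Definition degenerate (E : ellipse) : Prop := semi1 E = 0 \/ semi2 E = 0.

(** The affine chart carrying the unit circle onto the ellipse. *)
Definition chart (E : ellipse) (x y : R) : C :=
  (center E + axis E * ((semi1 E * x)%R, (semi2 E * y)%R))%C.

Definition on_ellipse (E : ellipse) (z : C) : Prop :=
  exists x y : R, x ^ 2 + y ^ 2 = 1 /\ z = chart E x y.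

Definition inside_ellipse (E : ellipse) (z : C) : Prop :=
  exists x y : R, x ^ 2 + y ^ 2 < 1 /\ z = chart E x y.

Definition nested (E E' : ellipse) : Prop :=
  forall z : C, on_ellipse E' z -> inside_ellipse E z.

Definition line_point (P Q : C) (t : R) : C := (P + RtoC t * (Q - P))%C.

Definition is_triangle (z1 z2 z3 : C) : Prop :=
  z1 <> z2 /\ ~ (exists t : R, z3 = line_point z1 z2 t).

(** For [P <> Q]: the line [PQ] meets the ellipse in exactly one point. *)
Definition side_tangent (E : ellipse) (P Q : C) : Prop :=
  exists! t : R, on_ellipse E (line_point P Q t).

Definition poncelet_triangle (E E' : ellipse) (z1 z2 z3 : C) : Prop :=
  is_triangle z1 z2 z3 /\
  (on_ellipse E z1 /\ on_ellipse E z2 /\ on_ellipse E z3) /\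
  (side_tangent E' z1 z2 /\ side_tangent E' z2 z3 /\ side_tangent E' z3 z1).

Definition similarity (s : C -> C) : Prop :=
  exists r : R, 0 < r /\
    forall z w : C, Cmod (s z - s w)%C = r * Cmod (z - w)%C.

(** Values of [F] outside genuine triangles are irrelevant.  Symmetry is
    required for a transposition and a 3-cycle, which generate all
    relabellings. *)
Definition triangle_center (F : C -> C -> C -> C) : Prop :=
  forall z1 z2 z3 : C, is_triangle z1 z2 z3 ->
    F z2 z1 z3 = F z1 z2 z3 /\
    F z2 z3 z1 = F z1 z2 z3 /\
    forall s : C -> C, similarity s ->
      F (s z1) (s z2) (s z3) = s (F z1 z2 z3).

Definition stationary (E E' : ellipse) (F : C -> C -> C -> C) : Prop :=
  exists P : C, forall z1 z2 z3 : C,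
    poncelet_triangle E E' z1 z2 z3 -> F z1 z2 z3 = P.

Definition barycenter (z1 z2 z3 : C) : C := ((z1 + z2 + z3) / RtoC 3)%C.

Definition is_circumcenter (z1 z2 z3 O : C) : Prop :=
  Cmod (O - z1)%C = Cmod (O - z2)%C /\ Cmod (O - z2)%C = Cmod (O - z3)%C.

(** [z] is the point [alpha X2 + beta X3 + gamma F] of the triangle. *)
Definition is_combination (alpha beta gamma : C) (F : C -> C -> C -> C)
    (z1 z2 z3 z : C) : Prop :=
  exists O : C, is_circumcenter z1 z2 z3 O /\
    z = (alpha * barycenter z1 z2 z3 + beta * O + gamma * F z1 z2 z3)%C.

Definition locus (E E' : ellipse) (alpha beta gamma : C)
    (F : C -> C -> C -> C) (z : C) : Prop :=
  exists z1 z2 z3 : C, poncelet_triangle E E' z1 z2 z3 /\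
    is_combination alpha beta gamma F z1 z2 z3 z.

(** Curves are functions on [R] of which only the restriction to [[0, 1]]
    matters. *)
Definition unit_itv (s : R) : Prop := 0 <= s <= 1.

(** [theta] is a continuous determination of the argument of [c - p]. *)
Definition argument_lift (c : R -> C) (p : C) (theta : R -> R) : Prop :=
  continuous_on unit_itv theta /\
  forall s : R, unit_itv s ->
    c s <> p /\
    (c s - p)%C = (RtoC (Cmod (c s - p)) * (cos (theta s), sin (theta s)))%C.

Definition is_winding_number (c : R -> C) (p : C) (n : Z) : Prop :=
  continuous_on unit_itv c /\ c 0 = c 1 /\
  exists theta : R -> R, argument_lift c p theta /\
    theta 1 - theta 0 = 2 * PI * IZR n.

Definition once_counterclockwise (c : R -> C) (p : C) : Prop :=
  continuous_on unit_itv c /\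
  exists theta : R -> R, argument_lift c p theta /\
    (forall s t : R, unit_itv s -> unit_itv t -> s < t -> theta s < theta t) /\
    theta 1 - theta 0 = 2 * PI.

(** The followed vertex is [z1]; no continuity is asked of the labelling
    [z2], [z3] of the other two vertices. *)
Definition full_cycle (E E' : ellipse) (z1 z2 z3 : R -> C) : Prop :=
  (forall s : R, unit_itv s -> poncelet_triangle E E' (z1 s) (z2 s) (z3 s)) /\
  once_counterclockwise z1 (center E).

(* Main.v *)
Require Import Defs.
From Stdlib Require Import Reals ZArith Lra Psatz ssreflect.
From Coquelicot Require Import Coquelicot.

(** An affine change of coordinates turns the outer ellipse into the unit circle
    and the inner one into an ellipse with foci [f], [g] in the open unit disc.
    For a Poncelet triangle with vertices [a1], [a2], [a3] on the unit circle,
    tangency of the chords from [a1] says that [a2], [a3] are the roots of a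
    quadratic polynomial depending on [a1]; by Vieta, [l := a1 a2 a3] equals the
    Blaschke product [a1 (a1 - f) (a1 - g) / ((1 - conj f a1) (1 - conj g a1))].
    The vertices are thus the roots of a cubic whose coefficients are affine in
    [l], so that the barycenter, and also the circumcenter, are of the form
    [X0 + v l + w conj l].  As [a1] turns once, [l] turns three times because the
    foci lie inside the unit disc.  Comparing Fourier coefficients, a
    parametrization [X0 + v l + w conj l] of a nondegenerate ellipse has center
    [X0] and [|v| <> |w|], hence turns three times in the direct or in the
    indirect sense according to the larger of [|v|], [|w|]. *)

Open Scope R_scope.

(** * Conjugates and moduli of complex numbers *)

Ltac cconj := rewrite ?(Cplus_conj, Cminus_conj, Cmult_conj, Copp_conj, Cconj_conj).

Lemma Cconj_R (x : R) : Cconj x = x.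
Proof. apply injective_projections; simpl; ring. Qed.

Lemma Cplus_reg_l (a b c : C) : (a + b)%C = (a + c)%C -> b = c.
Proof. intros h. replace b with (a + b - a)%C by ring. rewrite h. ring. Qed.

Lemma Cmult_reg_l (a b c : C) : a <> 0 -> (a * b)%C = (a * c)%C -> b = c.
Proof.
intros ha h. replace b with (/ a * (a * b))%C by (field; auto). rewrite h. field; auto.
Qed.

Lemma Cminus_neq0 (a b : C) : a <> b -> (a - b)%C <> 0.
Proof. intros h e; apply h. replace a with (a - b + b)%C by ring. rewrite e; ring. Qed.

Lemma Cmod1_conj (w : C) : Cmod w = 1 <-> (w * Cconj w)%C = 1.
Proof.
rewrite -Cmod2_conj. split; intros h.
- rewrite h. f_equal; ring.
- apply RtoC_inj in h. pose proof (Cmod_ge_0 w). nra.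
Qed.

Lemma Cmod1_neq0 (w : C) : Cmod w = 1 -> w <> 0.
Proof. intros h e. rewrite e Cmod_0 in h. lra. Qed.

Lemma Cconj_Cmod1 (w : C) : Cmod w = 1 -> Cconj w = (/ w)%C.
Proof.
intros h. apply (Cmult_reg_l w). now apply Cmod1_neq0.
rewrite (proj1 (Cmod1_conj w) h). field. now apply Cmod1_neq0.
Qed.

Lemma Cmult_eq0 (a b : C) : (a * b = 0)%C -> a = 0 \/ b = 0.
Proof.
intros h. assert (Cmod a * Cmod b = 0) as e by (rewrite -Cmod_mult h; apply Cmod_0).
apply Rmult_integral in e as [e|e]; apply Cmod_eq_0 in e; auto.
Qed.

Lemma Cconj_eq0 (a : C) : Cconj a = 0 -> a = 0.
Proof. intros h. apply Cmod_eq_0. rewrite -Cmod_conj h. apply Cmod_0. Qed.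

(** * Real-linear maps of the plane *)

(** Every real-linear endomorphism of the plane has this form. The condition [Cmod B < Cmod A] says
    that it is invertible and preserves orientation. *)
Definition rlin (A B w : C) : C := (A * w + B * Cconj w)%C.

(** The determinant of [rlin A B] as a real map, kept in [C] so that it can serve as a denominator
    for [field]. *)
Definition rdet (A B : C) : C := (A * Cconj A - B * Cconj B)%C.

Lemma rdet_neq0 (A B : C) : Cmod B < Cmod A -> rdet A B <> 0.
Proof.
intros h e. unfold rdet in e. rewrite -!Cmod2_conj -RtoC_minus in e.
apply RtoC_inj in e. pose proof (Cmod_ge_0 B). nra.
Qed.

Lemma rdet_conj (A B : C) : Cconj (rdet A B) = rdet A B.
Proof. unfold rdet. cconj. ring. Qed.

Lemma rlin_conj (A B w : C) : Cconj (rlin A B w) = rlin (Cconj B) (Cconj A) w.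
Proof. unfold rlin. cconj. ring. Qed.

Lemma rlin_comp (A B u v w : C) :
  rlin A B (rlin u v w) = rlin (A * u + B * Cconj v) (A * v + B * Cconj u) w.
Proof. unfold rlin. cconj. ring. Qed.

(** Cramer's rule for a linear system in [u] and [Cconj v] of determinant [rdet A B]. With
    [rlin_comp], every real-linear map factors through [rlin A B]; this expresses a second ellipse
    in the coordinates of a first one. *)
Lemma rlin_factor (A B A' B' : C) : Cmod B < Cmod A ->
  exists u v, A' = (A * u + B * Cconj v)%C /\ B' = (A * v + B * Cconj u)%C.
Proof.
intros h. pose proof (rdet_neq0 _ _ h) as hd.
exists ((Cconj A * A' - B * Cconj B') / rdet A B)%C, ((Cconj A * B' - B * Cconj A') / rdet A B)%C.
cconj. rewrite ?Cinv_conj // !rdet_conj. cconj.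
unfold rdet in *. split; field; exact hd.
Qed.

Lemma rlin_inv (A B : C) : Cmod B < Cmod A ->
  exists A' B', Cmod B' < Cmod A' /\ forall w,
    rlin A' B' (rlin A B w) = w /\ rlin A B (rlin A' B' w) = w.
Proof.
intros h. pose proof (rdet_neq0 _ _ h) as hd.
exists (Cconj A / rdet A B)%C, (- B / rdet A B)%C. split.
- rewrite !Cmod_div // Cmod_opp Cmod_conj. apply Rmult_lt_compat_r => //.
  apply Rinv_0_lt_compat. now apply Cmod_gt_0.
- intros w. unfold rlin. cconj. rewrite ?Cinv_conj // !rdet_conj. cconj.
  unfold rdet in *. split; field; exact hd.
Qed.

Lemma rlin_inj (A B w w' : C) : Cmod B < Cmod A -> rlin A B w = rlin A B w' -> w = w'.
Proof.
intros h e. destruct (rlin_inv _ _ h) as (A' & B' & _ & hi).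
now rewrite -(proj1 (hi w)) e (proj1 (hi w')).
Qed.

Lemma rlin_surj (A B z : C) : Cmod B < Cmod A -> exists w, rlin A B w = z.
Proof.
intros h. destruct (rlin_inv _ _ h) as (A' & B' & _ & hi). eexists. apply hi.
Qed.

(** * Ellipses as affine images of the unit circle *)

(** Scaling the coordinates by [semi1] and [semi2] is [rlin] with half the sum and half the
    difference of the semi-axes; both being positive, the sum dominates. *)
Lemma chart_rlin (E : ellipse) : ~ degenerate E ->
  exists A B, Cmod B < Cmod A /\
    forall x y, chart E x y = (center E + rlin A B (x, y))%C.
Proof.
intros hE.
exists (axis E * RtoC ((semi1 E + semi2 E) / 2))%C, (axis E * RtoC ((semi1 E - semi2 E) / 2))%C.
pose proof (semi1_ge0 E) as h1. pose proof (semi2_ge0 E) as h2.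
assert (semi1 E <> 0) by (intros e; apply hE; now left).
assert (semi2 E <> 0) by (intros e; apply hE; now right).
split.
- rewrite !Cmod_mult axis_unit !Cmod_R !Rmult_1_l. unfold Rabs.
  do 2 destruct Rcase_abs; lra.
- intros x y. unfold chart, rlin. f_equal. rewrite -!Cmult_assoc -Cmult_plus_distr_l.
  f_equal. unfold Cplus, Cmult, Cconj, RtoC; simpl. f_equal; field.
Qed.

Lemma Cmod_pair (x y : R) : Cmod (x, y) ^ 2 = x ^ 2 + y ^ 2.
Proof. now rewrite Cmod2_alt. Qed.

Lemma line_point_rlin (A B k w w' : C) (t : R) :
  line_point (k + rlin A B w) (k + rlin A B w') t = (k + rlin A B (line_point w w' t))%C.
Proof.
unfold line_point, rlin. cconj.
replace (Cconj t) with (RtoC t) by (unfold Cconj, RtoC; simpl; f_equal; ring). ring.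
Qed.

(** The conclusion says that the line is at distance 1 from the origin, i.e. that the discriminant
    of the quadratic in [t] vanishes. *)
Lemma unique_root_discriminant (x y dx dy : R) : dx ^ 2 + dy ^ 2 <> 0 ->
  (exists! t, (x + t * dx) ^ 2 + (y + t * dy) ^ 2 = 1) ->
  (x * dy - y * dx) ^ 2 = dx ^ 2 + dy ^ 2.
Proof.
intros hq (t & h & hu).
set q := dx ^ 2 + dy ^ 2 in hq. set m := x * dx + y * dy.
(* By Vieta [- 2 * m / q - t] is the other root, so uniqueness makes [t] a double root. *)
assert (- 2 * m / q - t = t) as e.
{ symmetry. apply hu. rewrite -h.
  transitivity ((x ^ 2 + y ^ 2) + (- 2 * m / q - t) * (2 * m + (- 2 * m / q - t) * q)).
  - unfold m, q. ring.
  - transitivity ((x ^ 2 + y ^ 2) + t * (2 * m + t * q)).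
    + field; exact hq.
    + unfold m, q. ring. }
assert (q * t = - m) as et by (apply (Rmult_eq_reg_l 2); [|lra]; transitivity (q * (t + t)); [ring|];
  rewrite -{1}e; field; exact hq).
assert (q * ((x + t * dx) ^ 2 + (y + t * dy) ^ 2) = q * 1) as h' by now rewrite h.
assert (q * ((x + t * dx) ^ 2 + (y + t * dy) ^ 2) = q * (x ^ 2 + y ^ 2) + 2 * m * (q * t) + (q * t) ^ 2) as h''
  by (unfold q, m; ring).
rewrite h'' et in h'. fold q. ring_simplify in h'. rewrite -h'. unfold q, m. ring.
Qed.

Section Chart.
Variables (E : ellipse) (A B : C).
Hypothesis hAB : Cmod B < Cmod A.
Hypothesis hE : forall x y, chart E x y = (center E + rlin A B (x, y))%C.

Lemma on_ellipse_rlin (w : C) : on_ellipse E (center E + rlin A B w)%C <-> Cmod w = 1.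
Proof.
split.
- intros (x & y & h & e). rewrite hE in e. apply Cplus_reg_l, rlin_inj in e => //.
  rewrite -Cmod_pair -e in h. pose proof (Cmod_ge_0 w). nra.
- intros h. exists (fst w), (snd w). rewrite hE -Cmod_pair -surjective_pairing h. split => //. ring.
Qed.

Lemma inside_ellipse_rlin (w : C) : inside_ellipse E (center E + rlin A B w)%C -> Cmod w < 1.
Proof.
intros (x & y & h & e). rewrite hE in e. apply Cplus_reg_l, rlin_inj in e => //.
rewrite -Cmod_pair -e in h. pose proof (Cmod_ge_0 w). nra.
Qed.

Lemma on_ellipse_rlin_ex (z : C) : on_ellipse E z ->
  exists w, Cmod w = 1 /\ z = (center E + rlin A B w)%C.
Proof.
intros h. destruct (rlin_surj A B (z - center E)%C hAB) as [w hw].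
assert (z = (center E + rlin A B w)%C) as e by (rewrite hw; ring).
exists w. split => //. apply on_ellipse_rlin. now rewrite -e.
Qed.

(** The bracket on the left is [- 2 i] times the cross product of [w] and [w'], so this is the
    discriminant condition for a line touching the unit circle. *)
Lemma side_tangent_rlin (w w' : C) : w <> w' ->
  side_tangent E (center E + rlin A B w) (center E + rlin A B w') ->
  ((w * Cconj w' - Cconj w * w') ^ 2 = - (4) * ((w' - w) * Cconj (w' - w)))%C.
Proof.
intros hne h. destruct w as [x y], w' as [x' y'].
assert (exists! t, (x + t * (x' - x)) ^ 2 + (y + t * (y' - y)) ^ 2 = 1) as hu.
{ assert (forall t, on_ellipse E (line_point (center E + rlin A B (x, y)) (center E + rlin A B (x', y')) t)
    <-> (x + t * (x' - x)) ^ 2 + (y + t * (y' - y)) ^ 2 = 1) as hi.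
  { intros t. rewrite line_point_rlin on_ellipse_rlin.
    replace (line_point (x, y) (x', y') t) with ((x + t * (x' - x), y + t * (y' - y)) : C)
      by (unfold line_point, Cplus, Cmult, Cminus, Copp, RtoC; simpl; f_equal; ring).
    rewrite -Cmod_pair. set m := Cmod _. assert (0 <= m) by apply Cmod_ge_0. split; nra. }
  destruct h as (t & ht & hu). exists t. split; [now apply hi|]. intros; now apply hu, hi. }
apply unique_root_discriminant in hu.
- apply injective_projections; simpl; nra.
- intros e. apply hne. rewrite -!Rsqr_pow2 in e. apply Rplus_sqr_eq_0 in e as [e1 e2].
  f_equal; lra.
Qed.

End Chart.

(** * Chords of the unit circle tangent to an ellipse *)

(* Vanishes exactly when the chord [ab] of the unit circle, i.e. the line
   [z + a b conj z = a + b], is tangent to the ellipse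
   [{c + u xi + v conj xi : |xi| = 1}]. *)
Definition chord_form (c u v a b : C) : C :=
  ((a + b - c - a * b * Cconj c) ^ 2
   - 4 * (u + a * b * Cconj v) * (v + a * b * Cconj u))%C.

(** Substituting the parametrization into the equation of the chord gives [U xi + V conj xi = W],
    and likewise for [eta]. Solving for [U D] and [V D] and multiplying, [D ^ 2 = - 4 N] yields
    [W ^ 2 = 4 U V]. *)
Lemma tangent_chord_form (c u v xi eta a b : C) :
  Cmod a = 1 -> Cmod b = 1 -> a <> b ->
  a = (c + rlin u v xi)%C -> b = (c + rlin u v eta)%C ->
  ((xi * Cconj eta - Cconj xi * eta) ^ 2 = - (4) * ((eta - xi) * Cconj (eta - xi)))%C ->
  chord_form c u v a b = 0.
Proof.
intros h1 h2 hne ha hb ht. unfold chord_form.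
apply Cmod1_conj in h1, h2.
set U := (u + a * b * Cconj v)%C. set V := (v + a * b * Cconj u)%C.
set W := (a + b - c - a * b * Cconj c)%C.
assert (Cconj a = Cconj c + rlin (Cconj v) (Cconj u) xi)%C as ha' by (now rewrite {1}ha Cplus_conj rlin_conj).
assert (Cconj b = Cconj c + rlin (Cconj v) (Cconj u) eta)%C as hb' by (now rewrite {1}hb Cplus_conj rlin_conj).
assert (U * xi + V * Cconj xi = W)%C as ea.
{ transitivity ((c + rlin u v xi) + a * b * (Cconj c + rlin (Cconj v) (Cconj u) xi) - c - a * b * Cconj c)%C;
    [unfold U, V, rlin; ring|].
  rewrite -ha -ha'. transitivity (a + b * (a * Cconj a) - c - a * b * Cconj c)%C; [ring|].
  rewrite h1. unfold W. ring. }
assert (U * eta + V * Cconj eta = W)%C as eb.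
{ transitivity ((c + rlin u v eta) + a * b * (Cconj c + rlin (Cconj v) (Cconj u) eta) - c - a * b * Cconj c)%C;
    [unfold U, V, rlin; ring|].
  rewrite -hb -hb'. transitivity (b + a * (b * Cconj b) - c - a * b * Cconj c)%C; [ring|].
  rewrite h2. unfold W. ring. }
set D := (xi * Cconj eta - Cconj xi * eta)%C in ht.
assert (U * D = W * Cconj (eta - xi))%C as eU.
{ cconj. transitivity ((U * xi + V * Cconj xi) * Cconj eta - (U * eta + V * Cconj eta) * Cconj xi)%C;
   [unfold D; ring|]. rewrite ea eb. ring. }
assert (V * D = - (W * (eta - xi)))%C as eV.
{ transitivity ((U * eta + V * Cconj eta) * xi - (U * xi + V * Cconj xi) * eta)%C;
   [unfold D; ring|]. rewrite ea eb. ring. }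
set N := ((eta - xi) * Cconj (eta - xi))%C in ht.
assert (N <> 0) as hN.
{ unfold N. rewrite -Cmod2_conj. intros e. apply RtoC_inj in e. apply hne.
  assert (Cmod (eta - xi) = 0) as e' by nra. apply Cmod_eq_0 in e'.
  rewrite ha hb. replace eta with (eta - xi + xi)%C by ring. rewrite e' Cplus_0_l. reflexivity. }
apply (Cmult_reg_l (- N)%C).
{ intros e. apply hN. replace N with (- - N)%C by ring. rewrite e. ring. }
transitivity (4 * N * U * V - N * W ^ 2)%C; [ring|].
assert ((U * D) * (V * D) = - (N * W ^ 2))%C as e by (rewrite eU eV; unfold N; ring).
replace ((U * D) * (V * D))%C with (U * V * D ^ 2)%C in e by ring. rewrite ht in e.
replace (4 * N * U * V)%C with (- (U * V * (- (4) * N)))%C by ring. rewrite e. ring.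
Qed.

(** For fixed [a], [chord_form] is a polynomial of degree at most 2 in [b]; its leading and constant
    coefficients appear on the two sides. *)
Lemma chord_form_vieta (c u v a b b' : C) : b <> b' ->
  chord_form c u v a b = 0 -> chord_form c u v a b' = 0 ->
  (b * b' * ((1 - a * Cconj c) ^ 2 - 4 * a ^ 2 * Cconj u * Cconj v))%C
  = ((a - c) ^ 2 - 4 * u * v)%C.
Proof.
intros hne h h'. apply (Cmult_reg_l (b - b')%C); [now apply Cminus_neq0|].
unfold chord_form in *. set l := (_ * (b * b' * _))%C. set r := (_ * (_ - _ * u * v))%C.
assert (l - r = b' * chord_form c u v a b - b * chord_form c u v a b')%C as e
  by (unfold l, r, chord_form; ring).
unfold chord_form in e. rewrite h h' in e.
replace l with (l - r + r)%C by ring. rewrite e. ring.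
Qed.

(** With [P] the cubic, [a2 P(a1) - a1 P(a2)] eliminates [e2] and equals
    [a1 a2 (a1 - a2) (a1 + a2 + a3 - e1)]. *)
Lemma cubic_sum_roots (e1 e2 a1 a2 a3 : C) :
  a1 <> 0 -> a2 <> 0 -> a1 <> a2 ->
  (a1 ^ 3 - e1 * a1 ^ 2 + e2 * a1 - a1 * a2 * a3 = 0)%C ->
  (a2 ^ 3 - e1 * a2 ^ 2 + e2 * a2 - a1 * a2 * a3 = 0)%C ->
  (a1 + a2 + a3 = e1)%C.
Proof.
intros h1 h2 hne q1 q2.
apply (Cmult_reg_l (a1 * a2 * (a1 - a2))%C).
{ apply Cmult_neq_0; [now apply Cmult_neq_0|now apply Cminus_neq0]. }
set l := (_ * (a1 + _ + _))%C. set r := (_ * e1)%C.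
transitivity (r + (l - r))%C; [ring|].
replace (l - r)%C with (a2 * (a1 ^ 3 - e1 * a1 ^ 2 + e2 * a1 - a1 * a2 * a3) -
  a1 * (a2 ^ 3 - e1 * a2 ^ 2 + e2 * a2 - a1 * a2 * a3))%C by (unfold l, r; ring).
rewrite q1 q2. ring.
Qed.

(** * Foci of an ellipse inside the unit disc *)

Lemma Csqrt_ex (z : C) : exists t : C, (t * t = z)%C.
Proof.
destruct z as [x y]. set m := Cmod (x, y).
assert (0 <= m) as hm by apply Cmod_ge_0.
assert (m ^ 2 = x ^ 2 + y ^ 2) as em by apply Cmod_pair.
pose proof (re_le_Cmod (x, y)) as hr. apply Rabs_le_between in hr. simpl in hr. fold m in hr.
assert (0 <= (m + x) / 2) as hp by lra.
assert (0 <= (m - x) / 2) as hq by lra.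
assert (sqrt ((m + x) / 2) * sqrt ((m - x) / 2) = Rabs y / 2) as es.
{ rewrite -sqrt_mult //. replace ((m + x) / 2 * ((m - x) / 2)) with ((y / 2)²).
  - rewrite sqrt_Rsqr_abs /Rdiv Rabs_mult (Rabs_pos_eq (/ 2)); lra.
  - unfold Rsqr. nra. }
pose proof (sqrt_sqrt _ hp) as ep. pose proof (sqrt_sqrt _ hq) as eq.
destruct (Rle_dec 0 y) as [hy | hy].
- rewrite Rabs_pos_eq // in es.
  exists (sqrt ((m + x) / 2), sqrt ((m - x) / 2)). apply injective_projections; simpl; lra.
- rewrite Rabs_left in es; [|lra].
  exists (sqrt ((m + x) / 2), - sqrt ((m - x) / 2)). apply injective_projections; simpl; lra.
Qed.

(** Convexity of the disc: [c + d] lies on the segment between [c - l d] and [c + l d]. *)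
Lemma Cmod_segment_lt (c d : C) (l : R) : 1 <= l ->
  Cmod (c + l * d) < 1 -> Cmod (c - l * d) < 1 -> Cmod (c + d) < 1.
Proof.
intros hl h h'.
replace (c + d)%C with (RtoC ((1 + / l) / 2) * (c + l * d) + RtoC ((1 - / l) / 2) * (c - l * d))%C.
2:{ apply injective_projections; simpl; field; lra. }
assert (0 < / l) by (apply Rinv_0_lt_compat; lra).
assert (/ l <= 1) by (rewrite -Rinv_1; apply Rinv_le_contravar; lra).
eapply Rle_lt_trans; [apply Cmod_triangle|].
rewrite !Cmod_mult !Cmod_R !Rabs_pos_eq; try lra.
nra.
Qed.

(* [f] and [g] are the foci of the ellipse [{c + u xi + v conj xi : |xi| = 1}]. *)
Lemma foci_ex (c u v : C) :
  (forall xi, Cmod xi = 1 -> Cmod (c + rlin u v xi) < 1) ->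
  exists f g, Cmod f < 1 /\ Cmod g < 1 /\ (f + g = 2 * c)%C /\ (f * g = c ^ 2 - 4 * u * v)%C.
Proof.
intros h. destruct (Csqrt_ex (u * v)%C) as [t ht].
exists (c + 2 * t)%C, (c - 2 * t)%C.
cut (Cmod (c + 2 * t) < 1 /\ Cmod (c - 2 * t) < 1).
{ intros [hf hg]. split; [exact hf|split; [exact hg|split]]; [ring|].
  transitivity (c ^ 2 - 4 * (t * t))%C; [ring|]. rewrite ht. ring. }
destruct (Req_dec (Cmod t) 0) as [t0 | t0].
(* Both foci are the center [c], the midpoint of two opposite points of the ellipse. *)
- apply Cmod_eq_0 in t0. rewrite t0.
  replace (c + 2 * 0)%C with (c + 0)%C by ring. replace (c - 2 * 0)%C with (c + 0)%C by ring.
  cut (Cmod (c + 0) < 1); [now split|].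
  replace (c + 0)%C with (c + 0 * rlin u v 1)%C by ring.
  assert (Cmod (c + 1 * rlin u v 1) < 1) as h1 by (rewrite Cmult_1_l; apply h, Cmod_1).
  assert (Cmod (c - 1 * rlin u v 1) < 1) as h2.
  { replace (c - 1 * rlin u v 1)%C with (c + rlin u v (- (1)))%C; [apply h, Cmod_m1|].
    unfold rlin. cconj. ring. }
  replace (c + 0 * rlin u v 1)%C with
    (RtoC (/ 2) * (c + 1 * rlin u v 1) + RtoC (/ 2) * (c - 1 * rlin u v 1))%C.
  2:{ apply injective_projections; simpl; field. }
  eapply Rle_lt_trans; [apply Cmod_triangle|].
  rewrite !Cmod_mult !Cmod_R !Rabs_pos_eq; lra.
- assert (Cmod t ^ 2 = Cmod u * Cmod v) as em by (rewrite -Cmod_mult -ht Cmod_mult; ring).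
  pose proof (Cmod_ge_0 t). pose proof (Cmod_ge_0 u). pose proof (Cmod_ge_0 v).
  assert (Cmod u <> 0) as u0 by (intros e; rewrite e in em; nra).
  (* The ratio of the major semi-axis to the distance from center to focus, at least 1 by the
     inequality of arithmetic and geometric means. *)
  set l := (Cmod u + Cmod v) / (2 * Cmod t).
  assert (1 <= l) as hl.
  { unfold l. apply (Rmult_le_reg_r (2 * Cmod t)); [lra|]. field_simplify; [|exact t0]. apply Rsqr_incr_0; unfold Rsqr; [pose proof (Rle_0_sqr (Cmod u - Cmod v)) as hs; unfold Rsqr in hs; lra| lra|lra]. }
  (* The parameter of an end of the major axis: it makes [u xi] and [v conj xi] nonnegative
     multiples of [t]. *)
  set xi := (Cconj u * t / RtoC (Cmod u * Cmod t))%C.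
  assert (RtoC (Cmod u) <> 0) as cu0 by (intros e; apply RtoC_inj in e; auto).
  assert (RtoC (Cmod t) <> 0) as ct0 by (intros e; apply RtoC_inj in e; auto).
  assert (u <> 0) as u0' by (intros e; apply u0; rewrite e; apply Cmod_0).
  assert (Cmod xi = 1) as hxi.
  { unfold xi. rewrite Cmod_div; [|rewrite RtoC_mult; now apply Cmult_neq_0].
    rewrite Cmod_mult Cmod_conj Cmod_R Rabs_pos_eq; [|nra]. field; auto. }
  assert (Cmod (- xi) = 1) as hxi' by now rewrite Cmod_opp.
  assert (rlin u v xi = RtoC l * (2 * t))%C as er.
  { apply (Cmult_reg_l u) => //. unfold rlin, xi, l.
    rewrite ?Cmult_conj Cinv_conj ?Cmult_conj ?Cconj_conj ?Cconj_R.
    2:{ rewrite RtoC_mult. now apply Cmult_neq_0. }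
    rewrite RtoC_div ?RtoC_mult ?RtoC_plus.
    pose proof (Cmod2_conj u) as eu. pose proof (Cmod2_conj t) as et.
    rewrite !RtoC_pow in eu, et.
    transitivity (((u * Cconj u) * u * t + u * (u * v) * Cconj t) / (Cmod u * Cmod t))%C.
    { field. auto. }
    rewrite -eu -ht.
    replace (u * (t * t) * Cconj t)%C with (u * t * (t * Cconj t))%C by ring. rewrite -et.
    assert (Cmod t ^ 2 = Cmod u * Cmod v)%C as em' by (rewrite -RtoC_pow em RtoC_mult //).
    rewrite em'. { field; auto. }
    lra. }
  pose proof (h xi hxi) as h1. pose proof (h _ hxi') as h2.
  replace (rlin u v (- xi)) with (- rlin u v xi)%C in h2 by (unfold rlin; cconj; ring).
  rewrite er in h1, h2. split.
  + now apply (Cmod_segment_lt _ _ l).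
  + replace (c - 2 * t)%C with (c + - (2 * t))%C by ring.
    apply (Cmod_segment_lt _ _ l) => //.
    * replace (c + l * - (2 * t))%C with (c + - (l * (2 * t)))%C by ring. exact h2.
    * replace (c - l * - (2 * t))%C with (c + (l * (2 * t)))%C by ring. exact h1.
Qed.

(** * The circumcenter in circle coordinates *)

(* [|o - rlin A B w| = r] is, on the unit circle, a quartic equation in [w];
   [a], [b], [c] being roots, eliminating its unknown coefficients in [w ^ 3] and
   [w ^ 2] leaves a linear equation for [o]. *)
Lemma circumcenter_unit (A B a b c o : C) (r : R) : Cmod B < Cmod A ->
  Cmod a = 1 -> Cmod b = 1 -> Cmod c = 1 -> a <> b -> b <> c -> c <> a ->
  Cmod (o - rlin A B a) = r -> Cmod (o - rlin A B b) = r -> Cmod (o - rlin A B c) = r ->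
  (rdet A B * o = A * (A * Cconj B * (a * b * c) + Cconj A * B * Cconj (a + b + c))
    - B * (Cconj A * B * Cconj (a * b * c) + A * Cconj B * (a + b + c)))%C.
Proof.
intros hAB ha hb hc hab hbc hca ra rb rc.
assert (forall w, Cmod w = 1 -> Cmod (o - rlin A B w) = r ->
  A * Cconj B * w ^ 4 - (o * Cconj B + Cconj o * A) * w ^ 3
  - (RtoC (r ^ 2) - o * Cconj o - A * Cconj A - B * Cconj B) * w ^ 2
  - (o * Cconj A + Cconj o * B) * w + Cconj A * B = 0)%C as hquart.
{ intros w hw hr. rewrite -hr Cmod2_conj. unfold rlin. cconj.
  pose proof (Cmod1_neq0 _ hw). rewrite !(Cconj_Cmod1 w hw). field. auto. }
pose proof (hquart a ha ra) as qa. pose proof (hquart b hb rb) as qb. pose proof (hquart c hc rc) as qc.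
clear hquart ra rb rc.
set Q := (o * Cconj B + Cconj o * A)%C in qa, qb, qc.
set Q' := (o * Cconj A + Cconj o * B)%C in qa, qb, qc.
set K := (RtoC (r ^ 2) - o * Cconj o - A * Cconj A - B * Cconj B)%C in qa, qb, qc.
pose proof (Cmod1_neq0 _ ha) as a0. pose proof (Cmod1_neq0 _ hb) as b0. pose proof (Cmod1_neq0 _ hc) as c0.
assert (Q' = A * Cconj B * (a * b * c) + Cconj A * B * Cconj (a + b + c))%C as eQ.
{ apply (Cmult_reg_l ((a - b) * (b - c) * (c - a) * (a * b * c))%C).
  { repeat apply Cmult_neq_0; auto using Cminus_neq0. }
  cconj. rewrite (Cconj_Cmod1 a) // (Cconj_Cmod1 b) // (Cconj_Cmod1 c) //.
  set l := (_ * Q')%C. set rr := (_ * (_ + _))%C.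
  (* The weights [(b - c) (b c) ^ 2] and their cyclic shifts cancel the terms in [Q] and [K], since
     [(b - c) + (c - a) + (a - b)] and [a (b - c) + b (c - a) + c (a - b)] vanish. *)
  assert (l - rr =
     (b - c) * (b * c) ^ 2 * (A * Cconj B * a ^ 4 - Q * a ^ 3 - K * a ^ 2 - Q' * a + Cconj A * B)
   + (c - a) * (c * a) ^ 2 * (A * Cconj B * b ^ 4 - Q * b ^ 3 - K * b ^ 2 - Q' * b + Cconj A * B)
   + (a - b) * (a * b) ^ 2 * (A * Cconj B * c ^ 4 - Q * c ^ 3 - K * c ^ 2 - Q' * c + Cconj A * B))%C as e.
  { unfold l, rr. field. auto. }
  rewrite qa qb qc in e. transitivity (l - rr + rr)%C; [ring|]. rewrite e. ring. }
(* So [Q'] determines [Q] as well, and the combination [A Q' - B Q] eliminates [Cconj o]. *)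
assert (Q = Cconj Q')%C as eQ' by (unfold Q, Q'; cconj; ring).
transitivity (A * Q' - B * Q)%C.
{ unfold rdet, Q, Q'. ring. }
rewrite eQ' eQ. cconj. ring.
Qed.

(** * Poncelet triangles in circle coordinates *)

Lemma is_triangle_neq (z1 z2 z3 : C) : is_triangle z1 z2 z3 ->
  z1 <> z2 /\ z2 <> z3 /\ z3 <> z1.
Proof.
intros [h1 h2]. split; [exact h1|split]; intros e; apply h2.
- exists 1. unfold line_point. rewrite e. ring.
- exists 0. unfold line_point. rewrite e. ring.
Qed.

Lemma chord_form_sym (c u v a b : C) : chord_form c u v a b = chord_form c u v b a.
Proof. unfold chord_form. ring. Qed.

Section Poncelet.
Variables (E E' : ellipse) (A B : C).
Hypothesis hAB : Cmod B < Cmod A.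
Hypothesis hE : forall x y, chart E x y = (center E + rlin A B (x, y))%C.

Local Notation pt w := (center E + rlin A B w)%C.

(** With [l = a1 a2 a3], Vieta for the two tangents from a vertex [a] gives [a (a - f) (a - g) = l
    (1 - conj f a) (1 - conj g a)]. As a cubic in [a] it has constant coefficient [- l] and
    quadratic coefficient [- (f + g + l conj (f g))], which gives the sum of the vertices. *)
Lemma poncelet_symmetric : ~ degenerate E' -> nested E E' ->
  exists f g, Cmod f < 1 /\ Cmod g < 1 /\ forall a1 a2 a3,
    Cmod a1 = 1 -> Cmod a2 = 1 -> Cmod a3 = 1 ->
    poncelet_triangle E E' (pt a1) (pt a2) (pt a3) ->
    (a1 + a2 + a3 = f + g + a1 * a2 * a3 * Cconj (f * g))%C /\
    (a1 * a2 * a3 * (1 - Cconj f * a1) * (1 - Cconj g * a1) = a1 * (a1 - f) * (a1 - g))%C.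
Proof.
intros hd hn. destruct (chart_rlin E' hd) as (A' & B' & hAB' & hE').
destruct (rlin_factor A B A' B' hAB) as (u & v & eA & eB).
(* In the coordinates where [E] is the unit circle, [E'] becomes [c + rlin u v]. *)
destruct (rlin_surj A B (center E' - center E)%C hAB) as [c hc].
assert (forall w, (center E' + rlin A' B' w = pt (c + rlin u v w))%C) as hpt.
{ intros w. replace (rlin A B (c + rlin u v w)) with (rlin A B c + rlin A B (rlin u v w))%C
    by (unfold rlin; cconj; ring).
  rewrite hc rlin_comp -eA -eB. ring. }
destruct (foci_ex c u v) as (f & g & hf & hg & es & ep).
{ intros w hw. apply (inside_ellipse_rlin E A B hAB hE). rewrite -hpt. apply hn.
  now apply (on_ellipse_rlin E' A' B' hAB' hE'). }
exists f, g. split; [exact hf|split; [exact hg|]].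
intros a1 a2 a3 h1 h2 h3 (ht & _ & t12 & t23 & t31).
destruct (is_triangle_neq _ _ _ ht) as (n12 & n23 & n31).
assert (forall a b, Cmod a = 1 -> Cmod b = 1 -> pt a <> pt b ->
  side_tangent E' (pt a) (pt b) -> chord_form c u v a b = 0) as hch.
{ intros a b ha hb hab t.
  destruct (rlin_surj A' B' (pt a - center E')%C hAB') as [xi hxi].
  destruct (rlin_surj A' B' (pt b - center E')%C hAB') as [eta heta].
  assert (pt a = center E' + rlin A' B' xi)%C as e1 by (rewrite hxi; ring).
  assert (pt b = center E' + rlin A' B' eta)%C as e2 by (rewrite heta; ring).
  apply (tangent_chord_form c u v xi eta) => //.
  - intros e. apply hab. now rewrite e.
  - apply (rlin_inj A B) => //. apply (Cplus_reg_l (center E)). now rewrite e1 hpt.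
  - apply (rlin_inj A B) => //. apply (Cplus_reg_l (center E)). now rewrite e2 hpt.
  - apply (side_tangent_rlin E' A' B' hAB' hE').
    + intros e. apply hab. now rewrite e1 e2 e.
    + now rewrite -e1 -e2. }
pose proof (hch _ _ h1 h2 n12 t12) as q12. pose proof (hch _ _ h2 h3 n23 t23) as q23.
pose proof (hch _ _ h3 h1 n31 t31) as q31.
assert (forall a b, pt a <> pt b -> a <> b) as hne by (intros a b h e; apply h; now rewrite e).
apply hne in n12, n23, n31.
(* The two coefficients in [chord_form_vieta] factor through the foci. *)
assert (forall a, ((1 - a * Cconj c) ^ 2 - 4 * a ^ 2 * Cconj u * Cconj v
   = (1 - Cconj f * a) * (1 - Cconj g * a))%C) as ef.
{ intros a. assert (Cconj f + Cconj g = 2 * Cconj c)%C as es'.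
  { now rewrite -Cplus_conj es Cmult_conj Cconj_R. }
  assert (Cconj f * Cconj g = Cconj c ^ 2 - 4 * Cconj u * Cconj v)%C as ep'.
  { now rewrite -Cmult_conj ep Cminus_conj Cpow_conj !Cmult_conj Cconj_R. }
  transitivity (1 - a * (2 * Cconj c) + a ^ 2 * (Cconj c ^ 2 - 4 * Cconj u * Cconj v))%C; [ring|].
  rewrite -es' -ep'. ring. }
assert (forall a, ((a - c) ^ 2 - 4 * u * v = (a - f) * (a - g))%C) as eg.
{ intros a. transitivity (a ^ 2 - a * (2 * c) + (c ^ 2 - 4 * u * v))%C; [ring|].
  rewrite -es -ep. ring. }
assert (forall a b b', b <> b' -> chord_form c u v a b = 0 -> chord_form c u v a b' = 0 ->
  (a * b * b' * (1 - Cconj f * a) * (1 - Cconj g * a) = a * (a - f) * (a - g))%C) as hv.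
{ intros a b b' n q q'. pose proof (chord_form_vieta _ _ _ _ _ _ n q q') as e.
  rewrite ef eg in e. transitivity (a * (b * b' * ((1 - Cconj f * a) * (1 - Cconj g * a))))%C; [ring|].
  rewrite e. ring. }
assert (a1 * a2 * a3 * (1 - Cconj f * a1) * (1 - Cconj g * a1) = a1 * (a1 - f) * (a1 - g))%C as v1.
{ apply hv => //. now rewrite chord_form_sym. }
assert (a1 * a2 * a3 * (1 - Cconj f * a2) * (1 - Cconj g * a2) = a2 * (a2 - f) * (a2 - g))%C as v2.
{ rewrite -(hv a2 a3 a1) //; [ring|]. now rewrite chord_form_sym. }
split; [|exact v1].
apply (cubic_sum_roots _ (f * g + a1 * a2 * a3 * Cconj (f + g))%C);
  [now apply Cmod1_neq0|now apply Cmod1_neq0|exact n12| |]; cconj.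
- transitivity (a1 * (a1 - f) * (a1 - g) - a1 * a2 * a3 * (1 - Cconj f * a1) * (1 - Cconj g * a1))%C;
    [ring|]. rewrite v1. ring.
- transitivity (a2 * (a2 - f) * (a2 - g) - a1 * a2 * a3 * (1 - Cconj f * a2) * (1 - Cconj g * a2))%C;
    [ring|]. rewrite v2. ring.
Qed.

Lemma is_circumcenter_rlin (a1 a2 a3 O : C) :
  Cmod a1 = 1 -> Cmod a2 = 1 -> Cmod a3 = 1 ->
  is_triangle (pt a1) (pt a2) (pt a3) -> is_circumcenter (pt a1) (pt a2) (pt a3) O ->
  O = (center E + (A * (A * Cconj B * (a1 * a2 * a3) + Cconj A * B * Cconj (a1 + a2 + a3))
    - B * (Cconj A * B * Cconj (a1 * a2 * a3) + A * Cconj B * (a1 + a2 + a3))) / rdet A B)%C.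
Proof.
intros h1 h2 h3 ht [e1 e2].
destruct (is_triangle_neq _ _ _ ht) as (n12 & n23 & n31).
pose proof (rdet_neq0 _ _ hAB) as hd.
rewrite -(circumcenter_unit A B a1 a2 a3 (O - center E)%C (Cmod (O - pt a1))) //.
- field. exact hd.
- intros e; apply n12; now rewrite e.
- intros e; apply n23; now rewrite e.
- intros e; apply n31; now rewrite e.
- f_equal; ring.
- rewrite e1. f_equal; ring.
- rewrite e1 e2. f_equal; ring.
Qed.

Lemma combination_trigonometric (alpha beta gamma : C) (F : C -> C -> C -> C) :
  ~ degenerate E' -> nested E E' -> stationary E E' F ->
  exists X0 v w, forall a1 a2 a3 z,
    Cmod a1 = 1 -> Cmod a2 = 1 -> Cmod a3 = 1 ->
    poncelet_triangle E E' (pt a1) (pt a2) (pt a3) ->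
    is_combination alpha beta gamma F (pt a1) (pt a2) (pt a3) z ->
    z = (X0 + rlin v w (a1 * a2 * a3))%C.
Proof.
intros hd hn [P hP]. destruct (poncelet_symmetric hd hn) as (f & g & _ & _ & hfg).
pose proof (rdet_neq0 _ _ hAB) as hdet.
set s := (f + g)%C. set p := (f * g)%C. set d := rdet A B.
(* The witnesses collect the constant terms and the coefficients of [l] and [conj l] after
   substituting [s + l conj p] for the sum of the vertices. *)
exists (alpha * (center E + (A * s + B * Cconj s) / 3)
   + beta * (center E + (A * Cconj A * B * Cconj s - A * B * Cconj B * s) / d) + gamma * P)%C.
exists (alpha * A * Cconj p / 3 + beta * (A * A * Cconj B - A * B * Cconj B * Cconj p) / d)%C.
exists (alpha * B * p / 3 + beta * (A * Cconj A * B * p - B * Cconj A * B) / d)%C.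
intros a1 a2 a3 z h1 h2 h3 ht (O & hO & ->).
rewrite (hP _ _ _ ht).
rewrite (is_circumcenter_rlin a1 a2 a3 O) //; [|apply ht].
destruct (hfg a1 a2 a3 h1 h2 h3 ht) as [e _].
unfold barycenter.
replace (pt a1 + pt a2 + pt a3)%C with (3 * center E + rlin A B (a1 + a2 + a3))%C
  by (unfold rlin; cconj; ring).
rewrite e. fold s p d. set l := (a1 * a2 * a3)%C. unfold rlin. cconj.
field. exact hdet.
Qed.

End Poncelet.

(** * Trigonometric parametrizations of an ellipse *)

(** The squared modulus is a trigonometric polynomial in [z], constant on the circle; these are its
    coefficients of [z ^ 2] and [z]. *)
Lemma circle_fourier (k m n : C) :
  (forall z, Cmod z = 1 -> Cmod (k + rlin m n z) = 1) ->
  (m * Cconj n = 0)%C /\ (k * Cconj n + Cconj k * m = 0)%C.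
Proof.
intros h.
assert (forall z, Cmod z = 1 -> ((k + rlin m n z) * Cconj (k + rlin m n z) = 1)%C) as hz
  by (intros z hz; now apply Cmod1_conj, h).
assert (Ci * Ci = - (1))%C as ii by (apply injective_projections; simpl; ring).
assert (Cconj Ci = - Ci)%C as ci by (apply injective_projections; simpl; ring).
assert (RtoC 4 <> 0) as n4 by (intros e; apply RtoC_inj in e; lra).
assert (RtoC 8 <> 0) as n8 by (intros e; apply RtoC_inj in e; lra).
assert (Ci <> 0) as ni by (intros e; apply (f_equal snd) in e; simpl in e; lra).
(* The alternating sum over [z], [- z], [i z], [- i z] isolates the terms of degree 2 and -2; below,
   the difference over [z] and [- z] isolates degrees 1 and -1. *)
assert (forall z, Cmod z = 1 ->
  (m * Cconj n * z ^ 2 + Cconj m * n * Cconj z ^ 2 = 0)%C) as h4.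
{ intros z z1. assert (Cmod (- z) = 1) as z2 by now rewrite Cmod_opp.
  assert (Cmod (Ci * z) = 1) as z3 by (rewrite Cmod_mult Cmod_Ci z1; ring).
  assert (Cmod (- (Ci * z)) = 1) as z4 by now rewrite Cmod_opp.
  apply (Cmult_reg_l 4) => //.
  transitivity ((k + rlin m n z) * Cconj (k + rlin m n z)
    + (k + rlin m n (- z)) * Cconj (k + rlin m n (- z))
    - (k + rlin m n (Ci * z)) * Cconj (k + rlin m n (Ci * z))
    - (k + rlin m n (- (Ci * z))) * Cconj (k + rlin m n (- (Ci * z))))%C.
  - unfold rlin. cconj. rewrite ci. ring [ii].
  - rewrite !hz //. ring. }
assert (forall z, Cmod z = 1 ->
  ((k * Cconj n + Cconj k * m) * z + (Cconj k * n + k * Cconj m) * Cconj z = 0)%C) as h2.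
{ intros z z1. assert (Cmod (- z) = 1) as z2 by now rewrite Cmod_opp.
  apply (Cmult_reg_l 4) => //.
  transitivity (2 * ((k + rlin m n z) * Cconj (k + rlin m n z)
    - (k + rlin m n (- z)) * Cconj (k + rlin m n (- z))))%C.
  - unfold rlin. cconj. ring.
  - rewrite !hz //. ring. }
split.
(* Evaluating at 1 and at a square root of [i] separates the two conjugate terms. *)
- destruct (Csqrt_ex Ci) as [z ez].
  assert (Cmod z = 1) as z1.
  { assert (Cmod z * Cmod z = 1) by (rewrite -Cmod_mult ez; apply Cmod_Ci).
    pose proof (Cmod_ge_0 z). nra. }
  pose proof (h4 1 Cmod_1) as e1. pose proof (h4 z z1) as e2.
  rewrite Cconj_R in e1.
  replace (z ^ 2)%C with Ci in e2 by (rewrite -ez; ring).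
  replace (Cconj z ^ 2)%C with (- Ci)%C in e2 by (rewrite -ci -ez; cconj; ring).
  apply (Cmult_reg_l (4 * Ci)%C); [now apply Cmult_neq_0|].
  transitivity (2 * Ci * (m * Cconj n * 1 ^ 2 + Cconj m * n * 1 ^ 2)
    + 2 * (m * Cconj n * Ci + Cconj m * n * - Ci))%C; [ring|].
  rewrite e1 e2. ring.
- pose proof (h2 1 Cmod_1) as e1. pose proof (h2 Ci Cmod_Ci) as e2.
  rewrite Cconj_R in e1. rewrite ci in e2.
  apply (Cmult_reg_l (4 * Ci)%C); [now apply Cmult_neq_0|].
  set p := (_ + Cconj k * m)%C in e1, e2 |- *. set q := (Cconj k * n + _)%C in e1, e2.
  transitivity (2 * Ci * (p * 1 + q * 1) + 2 * (p * Ci + q * - Ci))%C; [ring|].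
  rewrite e1 e2. ring.
Qed.

(** In the chart of [L] the curve becomes [k + rlin m n], mapping the circle into itself, so
    [circle_fourier] forces [k = 0] and one of [m], [n] to vanish. Then [v], [w] have the moduli of
    [A], [B] in some order, up to a common positive factor. *)
Lemma ellipse_parametrization (L : ellipse) (X0 v w : C) : ~ degenerate L ->
  (forall z, Cmod z = 1 -> on_ellipse L (X0 + rlin v w z)%C) ->
  ~ (v = 0 /\ w = 0) ->
  X0 = center L /\ Cmod v <> Cmod w.
Proof.
intros hd hon hvw. destruct (chart_rlin L hd) as (A & B & hAB & hL).
destruct (rlin_surj A B (X0 - center L)%C hAB) as [k hk].
destruct (rlin_factor A B v w hAB) as (m & n & ev & ew).
assert (forall z, (X0 + rlin v w z = center L + rlin A B (k + rlin m n z))%C) as hz.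
{ intros z. replace (rlin A B (k + rlin m n z)) with (rlin A B k + rlin A B (rlin m n z))%C
    by (unfold rlin; cconj; ring).
  rewrite hk rlin_comp -ev -ew. ring. }
destruct (circle_fourier k m n) as [hmn hkm].
{ intros z z1. apply (on_ellipse_rlin L A B hAB hL). rewrite -hz. now apply hon. }
assert (~ (m = 0 /\ n = 0)) as hmn0.
{ intros [e1 e2]. apply hvw. rewrite ev ew e1 e2.
  rewrite Cconj_R. split; ring. }
assert (k = 0 /\ Cmod v <> Cmod w) as [hk0 hc].
{ apply Cmult_eq0 in hmn as [e|e]; [|apply Cconj_eq0 in e]; rewrite e ?Cconj_R in hkm; rewrite ev ew e ?Cconj_R; split.
  - replace (k * Cconj n + Cconj k * 0)%C with (k * Cconj n)%C in hkm by ring.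
    apply Cmult_eq0 in hkm as [h|h] => //. apply Cconj_eq0 in h. now destruct hmn0.
  - replace (A * 0 + B * Cconj n)%C with (B * Cconj n)%C by ring.
    replace (A * n + B * 0)%C with (A * n)%C by ring.
    assert (n <> 0) as n0 by (intros e'; now apply hmn0). apply Cmod_gt_0 in n0.
    rewrite !Cmod_mult Cmod_conj. nra.
  - replace (k * 0 + Cconj k * m)%C with (Cconj k * m)%C in hkm by ring.
    apply Cmult_eq0 in hkm as [h|h]; [now apply Cconj_eq0|]. now destruct hmn0.
  - replace (A * m + B * 0)%C with (A * m)%C by ring.
    replace (A * 0 + B * Cconj m)%C with (B * Cconj m)%C by ring.
    assert (m <> 0) as n0 by (intros e'; now apply hmn0). apply Cmod_gt_0 in n0.
    rewrite !Cmod_mult Cmod_conj. nra. }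
split => //. apply (Cplus_reg_l (- center L)%C).
transitivity (X0 - center L)%C; [ring|]. rewrite -hk hk0. unfold rlin.
rewrite Cconj_R. ring.
Qed.

(** * Angles and continuous lifts *)

Definition cis (x : R) : C := (cos x, sin x).

Lemma Cmod_cis (x : R) : Cmod (cis x) = 1.
Proof.
assert (Cmod (cis x) ^ 2 = 1) as h.
{ unfold cis. rewrite Cmod_pair -(sin2_cos2 x). unfold Rsqr. ring. }
pose proof (Cmod_ge_0 (cis x)). nra.
Qed.

Lemma cis_plus (x y : R) : cis (x + y) = (cis x * cis y)%C.
Proof. apply injective_projections; simpl; [rewrite cos_plus|rewrite sin_plus]; ring. Qed.

Lemma cis_opp (x : R) : cis (- x) = Cconj (cis x).
Proof. apply injective_projections; simpl; [apply cos_neg|apply sin_neg]. Qed.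

Lemma cis_2PI (x : R) : cis (x + 2 * PI) = cis x.
Proof.
rewrite cis_plus. replace (cis (2 * PI)) with (RtoC 1); [ring|].
apply injective_projections; simpl; [now rewrite cos_2PI|now rewrite sin_2PI].
Qed.

Lemma cis_ex (w : C) : Cmod w = 1 -> exists x, 0 <= x <= 2 * PI /\ w = cis x.
Proof.
intros h. destruct w as [x y].
assert (x ^ 2 + y ^ 2 = 1) as e by (rewrite -Cmod_pair h; ring).
assert (-1 <= x <= 1) as hx by nra.
pose proof (acos_bound x). pose proof PI_RGT_0.
assert (sin (acos x) = Rabs y) as es.
{ rewrite sin_acos // -sqrt_Rsqr_abs. f_equal. unfold Rsqr. lra. }
destruct (Rle_dec 0 y) as [hy | hy].
- exists (acos x). split; [lra|]. unfold cis. rewrite es cos_acos // Rabs_pos_eq //.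
- exists (- acos x + 2 * PI). split; [lra|]. rewrite cis_2PI cis_opp. unfold cis, Cconj; simpl.
  rewrite es cos_acos // Rabs_left; [now rewrite Ropp_involutive|lra].
Qed.

(** The principal argument, used on the right half-plane only, where it is continuous. *)
Definition carg (w : C) : R := atan (Im w / Re w).

Lemma cis_carg (w : C) : 0 < Re w -> w = (Cmod w * cis (carg w))%C.
Proof.
destruct w as [x y]; intros h. simpl in h.
unfold carg, cis. rewrite cos_atan sin_atan. simpl.
assert (0 < 1 + (y / x)²) as hp by (pose proof (Rle_0_sqr (y / x)); lra).
assert (Cmod (x, y) = x * sqrt (1 + (y / x)²)) as em.
{ unfold Cmod; simpl. rewrite -{3}(sqrt_Rsqr x); [|lra]. rewrite -sqrt_mult.
  - f_equal. unfold Rsqr. field. lra.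
  - apply Rle_0_sqr.
  - lra. }
rewrite em. apply sqrt_lt_R0 in hp.
apply injective_projections; simpl; field; lra.
Qed.

Lemma cis_2carg (w : C) : 0 < Re w -> w = (Cconj w * cis (2 * carg w))%C.
Proof.
intros h. set c := cis (carg w).
assert (c * Cconj c = 1)%C as hc by apply Cmod1_conj, Cmod_cis.
replace (2 * carg w) with (carg w + carg w) by ring. rewrite cis_plus.
rewrite {1 2}(cis_carg w h) Cmult_conj Cconj_R. fold c.
transitivity (Cmod w * c * (c * Cconj c))%C; [rewrite hc|]; ring.
Qed.

Lemma Re_one_minus_pos (w : C) : Cmod w < 1 -> 0 < Re (1 - w)%C.
Proof. intros h. pose proof (re_le_Cmod w) as hr. apply Rabs_le_between in hr. simpl. unfold Re in hr. lra. Qed.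

Lemma continuous_Rplus (f g : R -> R) (x : R) :
  continuous f x -> continuous g x -> continuous (fun t => f t + g t) x.
Proof. apply (continuous_plus (V := R_NormedModule)). Qed.

Lemma continuous_Rmult (f g : R -> R) (x : R) :
  continuous f x -> continuous g x -> continuous (fun t => f t * g t) x.
Proof. apply (continuous_mult (K := R_AbsRing)). Qed.

(** Componentwise continuity, which reduces products and conjugates to real functions. *)
Definition Ccontinuous (f : R -> C) (x : R) : Prop :=
  continuous (fun t => Re (f t)) x /\ continuous (fun t => Im (f t)) x.

Lemma Ccontinuous_const (c : C) (x : R) : Ccontinuous (fun _ => c) x.
Proof. split; apply continuous_const. Qed.

Lemma Ccontinuous_plus (f g : R -> C) (x : R) :
  Ccontinuous f x -> Ccontinuous g x -> Ccontinuous (fun t => f t + g t)%C x.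
Proof. intros [] []. split; now apply continuous_Rplus. Qed.

Lemma Ccontinuous_opp (f : R -> C) (x : R) :
  Ccontinuous f x -> Ccontinuous (fun t => - f t)%C x.
Proof. intros []. split; now apply (continuous_opp (V := R_NormedModule)). Qed.

Lemma Ccontinuous_conj (f : R -> C) (x : R) :
  Ccontinuous f x -> Ccontinuous (fun t => Cconj (f t)) x.
Proof. intros []. split => //. now apply (continuous_opp (V := R_NormedModule)). Qed.

Lemma Ccontinuous_mult (f g : R -> C) (x : R) :
  Ccontinuous f x -> Ccontinuous g x -> Ccontinuous (fun t => f t * g t)%C x.
Proof.
intros [] []. split; apply continuous_Rplus; try now apply continuous_Rmult.
apply (continuous_opp (V := R_NormedModule)). now apply continuous_Rmult.
Qed.

Lemma Ccontinuous_cis (f : R -> R) (x : R) : continuous f x -> Ccontinuous (fun t => cis (f t)) x.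
Proof. intros h. split; [now apply continuous_cos_comp|now apply continuous_sin_comp]. Qed.

Lemma Ccontinuous_continuous (f : R -> C) (x : R) :
  Ccontinuous f x -> continuous (U := C_UniformSpace) f x.
Proof.
intros [h1 h2]. apply filterlim_locally => eps.
pose proof (proj1 (filterlim_locally _ _) h1 eps) as e1.
pose proof (proj1 (filterlim_locally _ _) h2 eps) as e2.
generalize (filter_and _ _ e1 e2). apply filter_imp. now intros y [].
Qed.

Lemma continuous_carg (f : R -> C) (x : R) :
  Ccontinuous f x -> 0 < Re (f x) -> continuous (fun t => carg (f t)) x.
Proof.
intros [h1 h2] h. apply continuous_atan_comp, continuous_Rmult => //.
apply continuous_Rinv_comp => //. lra.
Qed.

(* The last clause expresses that [G x - x] is [2 PI]-periodic.  Writing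
   [A z + B conj z = A z (1 + (B / A) conj z ^ 2)] for [|z| = 1], the last factor
   has positive real part. *)
Lemma rlin_lift (A B : C) : Cmod B < Cmod A ->
  exists G : R -> R, (forall x, continuous G x) /\
    (forall x, rlin A B (cis x) = (Cmod (rlin A B (cis x)) * cis (G x))%C) /\
    (forall x y, cis x = cis y -> G x - x = G y - y).
Proof.
intros h. pose proof (Cmod_ge_0 B).
assert (A <> 0) as hA by (apply Cmod_gt_0; lra).
assert (RtoC (Cmod A) <> 0) as hA' by (intros e; apply RtoC_inj in e; lra).
destruct (cis_ex (A / Cmod A)%C) as (al & _ & hal).
{ rewrite Cmod_div // Cmod_R Rabs_pos_eq; [|apply Cmod_ge_0]. field. lra. }
set k := (- (B / A))%C.
set W := fun x : R => (1 + - (k * (Cconj (cis x) * Cconj (cis x))))%C.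
assert (forall x, 0 < Re (W x)) as hW.
{ intros x. apply Re_one_minus_pos. unfold k. rewrite !Cmod_mult Cmod_opp Cmod_conj Cmod_cis Cmod_div //.
  apply (Rmult_lt_reg_r (Cmod A)); [lra|]. field_simplify; lra. }
assert (forall x, Ccontinuous W x) as cW.
{ intros x. apply Ccontinuous_plus; [apply Ccontinuous_const|]. apply Ccontinuous_opp.
  apply Ccontinuous_mult; [apply Ccontinuous_const|].
  apply Ccontinuous_mult; apply Ccontinuous_conj, Ccontinuous_cis, continuous_id. }
exists (fun x => al + x + carg (W x)). split; [|split].
- intros x. apply continuous_Rplus; [|now apply continuous_carg].
  apply continuous_Rplus; [apply continuous_const|apply continuous_id].
- intros x. assert (cis x * Cconj (cis x) = 1)%C as hc by apply Cmod1_conj, Cmod_cis.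
  assert (rlin A B (cis x) = A * cis x * W x)%C as e.
  { unfold rlin, W, k. transitivity (A * cis x + B * (cis x * Cconj (cis x)) * Cconj (cis x))%C.
    - rewrite hc. ring.
    - field. exact hA. }
  rewrite e !cis_plus -hal !Cmod_mult Cmod_cis Rmult_1_r RtoC_mult.
  rewrite {1}(cis_carg _ (hW x)). field. exact hA'.
- intros x y e. unfold W. rewrite e. ring.
Qed.

(* On the unit circle, [(a - f) / (1 - conj f * a) = a * w / conj w] with
   [w = 1 - f * conj a], whose real part is positive; hence the degree 3. *)
Lemma blaschke_lift (f g : C) : Cmod f < 1 -> Cmod g < 1 ->
  exists G : R -> R, (forall x, continuous G x) /\
    (forall x l, (l * (1 - Cconj f * cis x) * (1 - Cconj g * cis x)
       = cis x * (cis x - f) * (cis x - g))%C -> l = cis (G x)) /\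
    (forall x y, cis x = cis y -> G x - 3 * x = G y - 3 * y).
Proof.
intros hf hg.
set W := fun (f : C) (x : R) => (1 + - (f * Cconj (cis x)))%C.
assert (forall f x, Cmod f < 1 -> 0 < Re (W f x)) as hW.
{ intros h x hh. apply Re_one_minus_pos. now rewrite Cmod_mult Cmod_conj Cmod_cis Rmult_1_r. }
assert (forall f x, Ccontinuous (W f) x) as cW.
{ intros h x. apply Ccontinuous_plus; [apply Ccontinuous_const|]. apply Ccontinuous_opp.
  apply Ccontinuous_mult; [apply Ccontinuous_const|].
  apply Ccontinuous_conj, Ccontinuous_cis, continuous_id. }
exists (fun x => 3 * x + 2 * carg (W f x) + 2 * carg (W g x)). split; [|split].
- intros x. repeat apply continuous_Rplus; apply continuous_Rmult;
    try apply continuous_const; try (apply continuous_carg; auto). apply continuous_id.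
- intros x l e. set a := cis x in e.
  assert (a * Cconj a = 1)%C as hc by apply Cmod1_conj, Cmod_cis.
  assert (forall f, Cconj (W f x) = 1 - Cconj f * a)%C as ew.
  { intros h. unfold W. cconj. rewrite Cconj_R. unfold a. ring. }
  assert (forall f, a - f = a * W f x)%C as ew'.
  { intros h. transitivity (a - (a * Cconj a) * h)%C; [rewrite hc; ring|]. unfold W, a. ring. }
  (* The equation now reads [l conj (W f) conj (W g) = a ^ 3 W f W g], and each quotient
     [W / conj W] is [cis] of twice the argument of [W]. *)
  rewrite !ew' -!ew in e.
  assert (forall f, Cmod f < 1 -> Cconj (W f x) <> 0) as n0.
  { intros h hh e0. apply Cconj_eq0 in e0. pose proof (hW h x hh) as hp. rewrite e0 in hp. simpl in hp. lra. }
  apply (Cmult_reg_l (Cconj (W f x) * Cconj (W g x))%C); [apply Cmult_neq_0; auto|].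
  transitivity (l * Cconj (W f x) * Cconj (W g x))%C; [ring|]. rewrite e.
  replace (3 * x) with (x + (x + x)) by ring. rewrite !cis_plus. fold a.
  transitivity (a ^ 3 * (Cconj (W f x) * cis (2 * carg (W f x)))
    * (Cconj (W g x) * cis (2 * carg (W g x))))%C; [|ring].
  rewrite -!cis_2carg; [ring|now apply hW..].
- intros x y e. unfold W. rewrite e. ring.
Qed.

(** * Winding numbers along the cycle *)

(** Retraction onto the unit interval: composing with it extends a lift given on that interval to a
    continuous function on all of [R]. *)
Definition clamp (s : R) : R := Rmax 0 (Rmin s 1).

Lemma clamp_unit (s : R) : unit_itv (clamp s).
Proof. unfold unit_itv, clamp, Rmax, Rmin. do 2 destruct Rle_dec; lra. Qed.

Lemma clamp_id (s : R) : unit_itv s -> clamp s = s.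
Proof. unfold unit_itv, clamp, Rmax, Rmin. do 2 destruct Rle_dec; lra. Qed.

Lemma clamp_lipschitz (s t : R) : Rabs (clamp t - clamp s) <= Rabs (t - s).
Proof.
unfold clamp, Rmax, Rmin. repeat destruct Rle_dec; unfold Rabs; repeat destruct Rcase_abs; lra.
Qed.

Lemma continuous_clamp (f : R -> R) (s : R) :
  continuous_on unit_itv f -> continuous (fun t => f (clamp t)) s.
Proof.
intros h. pose proof (h (clamp s) (clamp_unit s)) as hs.
apply filterlim_locally => eps.
destruct (proj1 (filterlim_locally _ _) hs eps) as [d hd].
exists d => t ht. apply hd; [|apply clamp_unit].
eapply Rle_lt_trans; [apply clamp_lipschitz|exact ht].
Qed.

(** With [G] from [rlin_lift], [G (T s)] is an argument of [c s - p]. As [G x - x] depends only on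
    [cis x], it gains over the cycle exactly what [T] gains. *)
Lemma winding_rlin (c : R -> C) (p v w : C) (T : R -> R) (n : Z) :
  Cmod w < Cmod v -> (forall s, continuous T s) ->
  (forall s, unit_itv s -> c s = p + rlin v w (cis (T s)))%C ->
  cis (T 1) = cis (T 0) -> T 1 - T 0 = 2 * PI * IZR n ->
  is_winding_number c p n.
Proof.
intros hvw hT hc h01 hn. destruct (rlin_lift v w hvw) as (G & cG & eG & pG).
assert (unit_itv 0) as u0 by (unfold unit_itv; lra).
assert (unit_itv 1) as u1 by (unfold unit_itv; lra).
split; [|split].
- apply (continuous_on_ext _ (fun s => p + rlin v w (cis (T s)))%C).
  { intros s hs. now rewrite hc. }
  apply continuous_on_forall => s _. apply Ccontinuous_continuous.
  pose proof (Ccontinuous_cis T s (hT s)) as ct.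
  apply Ccontinuous_plus; [apply Ccontinuous_const|].
  apply Ccontinuous_plus; (apply Ccontinuous_mult; [apply Ccontinuous_const|]) => //.
  now apply Ccontinuous_conj.
- now rewrite !hc // h01.
- exists (fun s => G (T s)). split; [split|].
  + apply continuous_on_forall => s _. now apply continuous_comp.
  + intros s hs. rewrite hc //.
    replace (p + rlin v w (cis (T s)) - p)%C with (rlin v w (cis (T s))) by ring.
    split; [|apply eG]. intros e.
    assert (rlin v w (cis (T s)) = rlin v w 0) as e'.
    { apply (Cplus_reg_l p). rewrite e. unfold rlin. rewrite Cconj_R. ring. }
    apply rlin_inj in e' => //. pose proof (Cmod_cis (T s)) as h1. rewrite e' Cmod_0 in h1. lra.
  + pose proof (pG _ _ h01). lra.
Qed.

Lemma cis_turn_eq (x y : R) : x - y = 2 * PI -> cis x = cis y.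
Proof. intros h. rewrite -(cis_2PI y). f_equal. lra. Qed.

Lemma nonconstant_ellipse (L : ellipse) (p : C) : ~ degenerate L ->
  ~ (forall z, on_ellipse L z -> z = p).
Proof.
intros hd h. destruct (chart_rlin L hd) as (A & B & hAB & hL).
assert (RtoC 1 = - (1))%C as e.
{ apply (rlin_inj A B) => //. apply (Cplus_reg_l (center L)).
  rewrite (h (center L + rlin A B 1)%C); [|now apply (on_ellipse_rlin L A B hAB hL), Cmod_1].
  symmetry. apply h. now apply (on_ellipse_rlin L A B hAB hL), Cmod_m1. }
apply (f_equal fst) in e. simpl in e. lra.
Qed.

Theorem proposition2
    (E E' : ellipse)
    (HE : ~ degenerate E) (HE' : ~ degenerate E')
    (Hnested : nested E E')
    (Hfamily : exists z1 z2 z3 : C, poncelet_triangle E E' z1 z2 z3)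
    (Xk : C -> C -> C -> C)
    (Hcenter : triangle_center Xk)
    (Hstationary : stationary E E' Xk)
    (alpha beta gamma : C)
    (L : ellipse)
    (Hlocus : forall z : C,
        locus E E' alpha beta gamma Xk z <-> on_ellipse L z)
    (Hnondeg : ~ degenerate L)
    (z1 z2 z3 : R -> C)
    (Hcycle : full_cycle E E' z1 z2 z3)
    (X : R -> C)
    (HX : forall s : R, unit_itv s ->
        is_combination alpha beta gamma Xk (z1 s) (z2 s) (z3 s) (X s)) :
  is_winding_number X (center L) 3 \/ is_winding_number X (center L) (-3).
Proof.
destruct (chart_rlin E HE) as (A & B & hAB & hE).
destruct (rlin_inv A B hAB) as (A' & B' & hAB' & hinv).
(* [G] converts the argument of a point of [E] about its center into the argument of its circle
   coordinate. *)
destruct (rlin_lift A' B' hAB') as (G & cG & eG & pG).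
destruct (poncelet_symmetric E E' A B hAB hE HE' Hnested) as (f & g & hf & hg & hfg).
destruct (blaschke_lift f g hf hg) as (H & cH & eH & pH).
destruct (combination_trigonometric E E' A B hAB hE alpha beta gamma Xk HE' Hnested Hstationary)
  as (X0 & v & w & hX0).
destruct Hcycle as [htri (cz & theta & [ctheta etheta] & _ & turn)].
(* A continuous argument of the product of the three circle coordinates; [H] contributes the factor
   3 in the total [6 * PI]. *)
set T := fun s => H (G (theta (clamp s))).
assert (unit_itv 0) as u0 by (unfold unit_itv; lra).
assert (unit_itv 1) as u1 by (unfold unit_itv; lra).
assert (forall s, continuous T s) as cT.
{ intros s. apply (continuous_comp (fun s => G (theta (clamp s))) H); [|apply cH].
  apply (continuous_comp (fun s => theta (clamp s)) G); [|apply cG]. now apply continuous_clamp. }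
assert (cis (T 1) = cis (T 0) /\ T 1 - T 0 = 6 * PI) as [T01 turnT].
{ unfold T. rewrite !clamp_id //.
  pose proof (pG _ _ (cis_turn_eq _ _ turn)) as h1.
  assert (G (theta 1) - G (theta 0) = 2 * PI) as h2 by lra.
  pose proof (pH _ _ (cis_turn_eq _ _ h2)) as h3.
  assert (H (G (theta 1)) - H (G (theta 0)) = 6 * PI) as h4 by lra. split => //.
  transitivity (cis (H (G (theta 0)) + 2 * PI + 2 * PI + 2 * PI)); [f_equal; lra|now rewrite !cis_2PI]. }
assert (forall z1 z2 z3, poncelet_triangle E E' z1 z2 z3 -> exists a1 a2 a3,
  Cmod a1 = 1 /\ Cmod a2 = 1 /\ Cmod a3 = 1 /\ z1 = (center E + rlin A B a1)%C /\
  z2 = (center E + rlin A B a2)%C /\ z3 = (center E + rlin A B a3)%C) as hcoord.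
{ intros y1 y2 y3 (_ & (h1 & h2 & h3) & _).
  destruct (on_ellipse_rlin_ex E A B hAB hE y1 h1) as (a1 & ? & ?).
  destruct (on_ellipse_rlin_ex E A B hAB hE y2 h2) as (a2 & ? & ?).
  destruct (on_ellipse_rlin_ex E A B hAB hE y3 h3) as (a3 & ? & ?).
  now exists a1, a2, a3. }
assert (forall s, unit_itv s -> X s = X0 + rlin v w (cis (T s)))%C as eX.
{ intros s hs. pose proof (HX s hs) as hXs. pose proof (htri s hs) as ht.
  destruct (hcoord _ _ _ ht) as (a1 & a2 & a3 & h1 & h2 & h3 & e1 & e2 & e3).
  rewrite e1 e2 e3 in ht, hXs. rewrite (hX0 a1 a2 a3 (X s)) //. do 2 f_equal.
  apply eH. unfold T. rewrite clamp_id //.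
  (* [a1] is a nonnegative multiple [q] of [cis (G (theta s))], and both have modulus 1, so
     [q = 1]. *)
  replace (cis (G (theta s))) with a1; [now apply hfg|].
  destruct (etheta s hs) as [_ et]. rewrite e1 in et.
  set r := Cmod _ in et.
  assert (a1 = r * Cmod (rlin A' B' (cis (theta s))) * cis (G (theta s)))%C as ea.
  { rewrite -Cmult_assoc -eG. rewrite -{1}(proj1 (hinv a1)).
    replace (rlin A B a1) with (center E + rlin A B a1 - center E)%C by ring. rewrite et.
    unfold rlin, cis. cconj. rewrite Cconj_R. ring. }
  rewrite -RtoC_mult in ea. set q := (r * _)%R in ea.
  assert (0 <= q) as hq by (apply Rmult_le_pos; apply Cmod_ge_0).
  pose proof h1 as hq1. rewrite ea Cmod_mult Cmod_cis Cmod_R Rabs_pos_eq // Rmult_1_r in hq1.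
  rewrite ea hq1. ring. }
destruct (ellipse_parametrization L X0 v w Hnondeg) as [-> hvw].
(* [T] gains more than one turn, so by the intermediate value theorem every unit [z] is [cis (T s)]
   for some [s], and the corresponding point is in the locus. *)
{ intros z hz.
  destruct (cis_ex (z * Cconj (cis (T 0)))%C) as (b & hb & eb).
  { now rewrite Cmod_mult Cmod_conj hz Cmod_cis Rmult_1_r. }
  destruct (IVT_gen T 0 1 (T 0 + b)) as (s & hs & es).
  - intros s. apply continuity_pt_filterlim, cT.
  - rewrite Rmin_left ?Rmax_right; lra.
  - rewrite Rmin_left ?Rmax_right in hs; try lra.
    replace z with (cis (T s)).
    + rewrite -eX //. apply Hlocus. exists (z1 s), (z2 s), (z3 s). split; auto.
    + rewrite es cis_plus -eb. transitivity (z * (cis (T 0) * Cconj (cis (T 0))))%C; [ring|].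
      rewrite (proj1 (Cmod1_conj _) (Cmod_cis (T 0))). ring. }
(* If both coefficients vanished, the locus would be the single point [X0]. *)
{ intros [-> ->]. apply (nonconstant_ellipse L X0 Hnondeg) => z hz.
  apply Hlocus in hz as (y1 & y2 & y3 & ht & hc).
  destruct (hcoord _ _ _ ht) as (a1 & a2 & a3 & h1 & h2 & h3 & -> & -> & ->).
  rewrite (hX0 a1 a2 a3 z) //. unfold rlin. ring. }
destruct (Rtotal_order (Cmod w) (Cmod v)) as [h | [h | h]].
- left. apply (winding_rlin X _ v w T) => //. rewrite turnT. simpl. ring.
- now symmetry in h.
(* Replacing [T] by [- T] exchanges [v] and [w], so the dominant term turns backwards. *)
- right. apply (winding_rlin X _ w v (fun s => - T s)) => //.
  + intros s. now apply (continuous_opp (V := R_NormedModule)).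
  + intros s hs. rewrite eX // cis_opp. unfold rlin. rewrite Cconj_conj. ring.
  + now rewrite !cis_opp T01.
  + replace (-3)%Z with (- (3))%Z by reflexivity. rewrite opp_IZR. lra.
Qed.
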